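(* Let $H$ be a nonzero complex Hilbert space and let $V\subseteq\{\xi\in H:\|\xi\|=1\}$ be a norm-closed set satisfying V1: $\lambda\cdot V\subseteq V$ for every $\lambda\in\mathbb C$ with $|\lambda|=1$; and V2: for $\xi\in H$, if $\langle\xi,\eta\rangle=0$ for all $\eta\in V$ then $\xi=0$. If $r(V)>0$, then for every unit vector $\xi\in H$ the following three assertions are equivalent: (i) $\|\xi\|_V=r(V)$ is minimum (i.e. $\|\xi\|_V$ equals $r(V)$, which is the minimum possible value over unit vectors). (ii) $\|\xi\|^V=r(V)^{-1}$ is maximum (i.e. $\|\xi\|^V$ equals $r(V)^{-1}$, which is the maximum possible value over unit vectors). (iii) $d(\xi,V)=\sqrt{2(1-r(V))}$ is maximum (i.e. $d(\xi,V)$ equals $\sqrt{2(1-r(V))}$, which is the maximum possible value over unit vectors; equivalently $\xi$ is a maximal vector).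
   Context: The inner radius $r(V)$ is the largest $r\ge0$ such that $\{\xi\in H:\|\xi\|\le r\}$ is contained in the closed convex hull of $V$. For $\xi\in H$: $\|\xi\|_V=\sup_{\eta\in V}|\langle\xi,\eta\rangle|$; $\|\xi\|^V=\sup\{|\langle\xi,\eta\rangle|:\eta\in H,\ \|\eta\|_V\le1\}$; $d(\xi,V)=\inf\{\|\xi-\eta\|:\eta\in V\}$. A maximal vector is a unit vector $\xi$ with $d(\xi,V)=\sup_{\|\eta\|=1}d(\eta,V)$. *)

(* Defs.v *)
From HB Require Import structures.
From mathcomp Require Import all_boot all_order all_algebra.
From mathcomp Require Import sesquilinear complex.
From mathcomp Require Import all_classical all_reals all_analysis.

Set Implicit Arguments.
Unset Strict Implicit.
Unset Printing Implicit Defensive.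

Import Order.TTheory GRing.Theory Num.Theory.
Import numFieldNormedType.Exports.

Local Open Scope classical_set_scope.
Local Open Scope ring_scope.

(* A complex Hilbert space is a complete normed space over R[i] whose norm is
   induced by a dot product; as in [{dot H for _}], the product is linear in
   its first argument. *)
Definition norm_from_dot (R : realType) (H : completeNormedModType R[i])
    (dot : {dot H for Num.Def.conjC}) :=
  forall x : H, `|x| ^+ 2 = dot x x.

Section hilbert.
Variables (R : realType) (H : completeNormedModType R[i]).
Variable dot : {dot H for Num.Def.conjC}.
Implicit Types (V : set H) (x y : H).

(* `|x| lives in R[i] (it is real and nonnegative there); suprema and infima
   are taken in R, so norms and moduli are moved to R. *)
Definition rnorm x : R := complex.Re `|x|.

Definition rmod (z : R[i]) : R := complex.Re `|z|.

Definition usphere : set H := [set x | `|x| = 1].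

(* The scalars of [convex_set] are the elements of R[i] between 0 and 1,
   i.e. the reals of [0, 1]. *)
Definition closed_convex_hull V : set H :=
  smallest [set A : set H | @convex_set R[i] H A /\ closed A] V.

(* The set of radii is closed, and it is bounded when H is nonzero and V is
   bounded, so the supremum is then the largest radius as soon as the set is
   nonempty. *)
Definition inner_radius V : R :=
  sup [set r : R | 0 <= r /\ [set x | rnorm x <= r] `<=` closed_convex_hull V].

Definition normV V x : R := sup [set rmod (dot x y) | y in V].

(* Extended-real valued: the supremum may be infinite. *)
Definition dual_normV V x : \bar R :=
  ereal_sup [set (rmod (dot x y))%:E | y in [set y | normV V y <= 1]].

Definition distV V x : R := inf [set rnorm (x - y) | y in V].

Definition maximal_vector V x :=
  usphere x /\ distV V x = sup [set distV V y | y in usphere].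

End hilbert.

(* Main.v *)
(* Since V is stable under rotations, ‖x‖_V is the supremum over V of the real
   inner product Re<x, y>. Each half-space {z | Re<z, y> <= ‖y‖_V} is closed,
   convex and contains V, so it contains the ball of radius r(V), whence
   r(V) ‖y‖ <= ‖y‖_V; separating a point from the hull gives the converse, and
   r(V) is the infimum of ‖y‖_V over unit vectors. On unit vectors
   d(x, V) = sqrt (2 (1 - ‖x‖_V)), so the distance is largest where ‖x‖_V is
   smallest. For the dual norm, ‖x‖_V = r(V) makes x / r(V) a competitor with
   value 1 / r(V); conversely a near-optimal competitor has norm at most
   1 / r(V), hence is close to x / r(V). *)
Require Import Defs.
From HB Require Import structures.
From mathcomp Require Import all_boot all_order all_algebra.
From mathcomp Require Import sesquilinear complex.
From mathcomp Require Import all_classical all_reals all_analysis.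
From mathcomp Require Import ring lra.

Set Implicit Arguments.
Unset Strict Implicit.
Unset Printing Implicit Defensive.

Import Order.TTheory GRing.Theory Num.Theory.
Import numFieldNormedType.Exports.

Local Open Scope classical_set_scope.
Local Open Scope ring_scope.

(** * Moduli of complex scalars, as reals *)

Section rmod.
Variable R : realType.
Implicit Types z : R[i].

Lemma Re_le_rmod z : complex.Re z <= rmod z.
Proof.
have := normc_ge_Re z; rewrite /rmod lecE => /andP[_].
exact/le_trans/ler_norm.
Qed.

Lemma rmod_ge0 z : 0 <= rmod z.
Proof. by have := normr_ge0 z; rewrite lecE => /andP[_]. Qed.

Lemma rmodM z1 z2 : rmod (z1 * z2) = rmod z1 * rmod z2.
Proof. by rewrite /rmod normrM !normc_def /= mulr0 subr0. Qed.

Lemma rmodR (a : R) : rmod a%:C%C = `|a|.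
Proof. by rewrite /rmod normc_def /= expr0n addr0 sqrtr_sqr. Qed.

Lemma unimodular_rotation z :
  exists2 l : R[i], `|l| = 1 & l * z = (rmod z)%:C%C.
Proof.
have nE : `|z| = (rmod z)%:C%C by rewrite /rmod normc_def.
have [->|z0] := eqVneq z 0.
  by exists 1; rewrite ?normr1// mulr0 /rmod normr0.
exists (`|z| / z); last by rewrite divfK.
by rewrite normf_div normr_id divff// normr_eq0.
Qed.

End rmod.

(** * The underlying real inner product and Cauchy-Schwarz *)

Section real_inner_product.
Variables (R : realType) (H : completeNormedModType R[i]).
Variable dot : {dot H for Num.Def.conjC}.
Hypothesis norm_dot : norm_from_dot dot.
Implicit Types (x y z : H) (a : R) (l : R[i]).

Definition redot x y : R := complex.Re (dot x y).

Lemma normE x : `|x| = (rnorm x)%:C%C.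
Proof.
rewrite /rnorm; have := normr_ge0 x; case: `|x| => u v.
by rewrite lecE /= => /andP[/eqP -> _].
Qed.

Lemma rnorm_ge0 x : 0 <= rnorm x.
Proof. by have := normr_ge0 x; rewrite lecE => /andP[_]. Qed.

Lemma rnorm_eq0 x : (rnorm x == 0) = (x == 0).
Proof. by rewrite -(@normr_eq0 _ H) (normE x) eq_complex /= eqxx andbT. Qed.

Lemma rnormZ l x : rnorm (l *: x) = rmod l * rnorm x.
Proof. by rewrite [in LHS]/rnorm normrZ (normE x) /rmod normc_def /= mul0r subr0. Qed.

Lemma usphereE x : usphere x <-> rnorm x = 1.
Proof.
by rewrite /usphere /= normE; split=> [[]|->].
Qed.

Lemma rnorm_sqr x : rnorm x ^+ 2 = redot x x.
Proof.
by rewrite /redot -norm_dot normE -rmorphXn.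
Qed.

Lemma redotC x y : redot x y = redot y x.
Proof.
rewrite /redot [dot x y]hermC /= expr0 mul1r.
by case: (dot y x).
Qed.

Lemma redotDl x y z : redot (x + y) z = redot x z + redot y z.
Proof. by rewrite /redot linearDl /=; case: (dot x z); case: (dot y z). Qed.

Lemma redotZl a x y : redot (a%:C%C *: x) y = a * redot x y.
Proof. by rewrite /redot linearZl_LR /=; case: (dot x y) => u v /=; rewrite mul0r subr0. Qed.

Lemma redotNl x y : redot (- x) y = - redot x y.
Proof. by rewrite /redot linearNl /=; case: (dot x y). Qed.

Lemma redotBl x y z : redot (x - y) z = redot x z - redot y z.
Proof. by rewrite redotDl redotNl. Qed.

Lemma redotDr x y z : redot x (y + z) = redot x y + redot x z.
Proof. by rewrite !(redotC x) redotDl. Qed.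

Lemma redotBr x y z : redot x (y - z) = redot x y - redot x z.
Proof. by rewrite !(redotC x) redotBl. Qed.

Lemma redotZr a x y : redot x (a%:C%C *: y) = a * redot x y.
Proof. by rewrite !(redotC x) redotZl. Qed.

Definition redotE := (redotBl, redotBr, redotDl, redotDr, redotZl, redotZr).

Lemma rnormB_sqr x y :
  rnorm (x - y) ^+ 2 = rnorm x ^+ 2 - 2 * redot x y + rnorm y ^+ 2.
Proof. by rewrite !rnorm_sqr !redotE (redotC y x); ring. Qed.

Lemma rnormB_sqr_le x y :
  rnorm (x - y) ^+ 2 <= 2 * (rnorm x ^+ 2 + rnorm y ^+ 2).
Proof.
have := sqr_ge0 (rnorm (x + y)).
by rewrite !rnorm_sqr !redotE (redotC y x); lra.
Qed.

(** Cauchy-Schwarz: with p = ‖x‖ and q = ‖y‖, the squared norm of q x - p y expands to 2pq (pq -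
    [redot x y]), and pq can be cancelled once both vectors are nonzero. *)
Lemma redot_le x y : redot x y <= rnorm x * rnorm y.
Proof.
have [->|x0] := eqVneq x 0.
  by rewrite /redot linear0l /= mulr_ge0 ?rnorm_ge0.
have [->|y0] := eqVneq y 0.
  by rewrite /redot linear0r /= mulr_ge0 ?rnorm_ge0.
have pos : 0 < rnorm x * rnorm y.
  by rewrite mulr_gt0// lt_def rnorm_ge0 rnorm_eq0 ?x0 ?y0.
have := sqr_ge0 (rnorm ((rnorm y)%:C%C *: x - (rnorm x)%:C%C *: y)).
rewrite rnormB_sqr !rnormZ !rmodR !ger0_norm ?rnorm_ge0// redotZl redotZr.
set p := rnorm x; set q := rnorm y => h.
rewrite -(ler_pM2l pos) -/p -/q; nra.
Qed.

Lemma dot_rotation x y :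
  exists2 l, `|l| = 1 & redot x (l *: y) = rmod (dot x y).
Proof.
have [l l1 lE] := unimodular_rotation (dot x y).
(* [dot] is conjugate-linear in its second argument, hence the conjugate. *)
exists (Num.conj l); first by rewrite norm_conjC.
by rewrite /redot linearZr_LR /= conjCK lE.
Qed.

Lemma rmod_dot_le x y : rmod (dot x y) <= rnorm x * rnorm y.
Proof.
have [l l1 <-] := dot_rotation x y; apply: le_trans (redot_le _ _) _.
by rewrite rnormZ /rmod l1 mul1r.
Qed.

End real_inner_product.

(** * The norm and the distance given by a circled set of unit vectors *)

Section circled_set.
Variables (R : realType) (H : completeNormedModType R[i]).
Variable dot : {dot H for Num.Def.conjC}.
Hypothesis norm_dot : norm_from_dot dot.
Variable V : set H.
Hypothesis V_neq0 : V !=set0.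
Hypothesis V_sphere : V `<=` @usphere R H.
Hypothesis V_circled : forall (l : R[i]) (x : H), `|l| = 1 -> V x -> V (l *: x).
Implicit Types (x y z : H) (s c : R) (l : R[i]).

Local Notation redot := (redot dot).
Local Notation normV := (normV dot V).
Local Notation distV := (distV V).
Local Notation r := (inner_radius V).

Lemma rnorm_V y : V y -> rnorm y = 1.
Proof. by move/V_sphere/usphereE. Qed.

Lemma normV_has_sup x : has_sup [set rmod (dot x y) | y in V].
Proof.
split; first by case: V_neq0 => y Vy; exists (rmod (dot x y)), y.
exists (rnorm x) => _ [y Vy <-]; apply: le_trans (rmod_dot_le norm_dot _ _) _.
by rewrite (rnorm_V Vy) mulr1.
Qed.

Lemma rmod_le_normV x y : V y -> rmod (dot x y) <= normV x.
Proof. by move=> Vy; apply: sup_upper_bound (normV_has_sup x) _ _; exists y. Qed.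

Lemma redot_le_normV x y : V y -> redot x y <= normV x.
Proof. by move/(rmod_le_normV x); apply/le_trans/Re_le_rmod. Qed.

(** Rotating [y] inside the circled set [V] turns the modulus of [dot x y] into a real inner
    product, so bounding real parts is enough. *)
Lemma normV_le x c : (forall y, V y -> redot x y <= c) -> normV x <= c.
Proof.
move=> xc; apply: ge_sup; first by case: (normV_has_sup x).
move=> _ [y Vy <-]; have [l l1 <-] := dot_rotation dot x y.
exact/xc/V_circled.
Qed.

Lemma normV_ge0 x : 0 <= normV x.
Proof.
by case: V_neq0 => y /(rmod_le_normV x); apply: le_trans (rmod_ge0 _).
Qed.

Lemma normV_le_rnorm x : normV x <= rnorm x.
Proof.
apply: normV_le => y Vy; apply: le_trans (redot_le norm_dot _ _) _.
by rewrite (rnorm_V Vy) mulr1.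
Qed.

Lemma normVZ_le l x : normV (l *: x) <= rmod l * normV x.
Proof.
apply: normV_le => y Vy; apply: le_trans (Re_le_rmod _) _.
by rewrite linearZl_LR /= rmodM ler_wpM2l ?rmod_ge0// rmod_le_normV.
Qed.

Lemma normVD_le x y : normV (x + y) <= normV x + normV y.
Proof.
by apply: normV_le => z Vz; rewrite redotDl lerD// redot_le_normV.
Qed.

(** For unit vectors ‖x - y‖² = 2 (1 - [redot x y]), so an infimum of distances corresponds to a
    supremum of real inner products. *)
Lemma distVE x : rnorm x = 1 -> distV x = Num.sqrt (2 * (1 - normV x)).
Proof.
move=> x1.
have xV y : V y -> rnorm (x - y) ^+ 2 = 2 * (1 - redot x y).
  by move=> Vy; rewrite (rnormB_sqr norm_dot) x1 (rnorm_V Vy); ring.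
have ne : [set rnorm (x - y) | y in V] !=set0.
  by case: V_neq0 => y Vy; exists (rnorm (x - y)), y.
apply/eqP; rewrite eq_le; apply/andP; split; last first.
  apply: lb_le_inf => // _ [y Vy <-].
  rewrite -(ger0_norm (rnorm_ge0 (x - y))) -sqrtr_sqr xV// ler_wsqrtr//.
  by rewrite ler_wpM2l// lerB// redot_le_normV.
have lb0 : lbound [set rnorm (x - y) | y in V] 0.
  by move=> _ [y Vy <-]; exact: rnorm_ge0.
have d0 : 0 <= distV x by exact: lb_le_inf.
rewrite -(ger0_norm d0) -sqrtr_sqr ler_wsqrtr//.
suff : normV x <= 1 - distV x ^+ 2 / 2 by lra.
apply: normV_le => y Vy.
have : distV x ^+ 2 <= rnorm (x - y) ^+ 2.
  rewrite ler_pXn2r ?nnegrE ?rnorm_ge0//; apply: ge_inf; last by exists y.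
  by exists 0.
by rewrite xV//; lra.
Qed.

(** * Half-spaces, the closed convex hull and separation *)

Lemma halfspace_closed y c : closed [set z | redot z y <= c].
Proof.
move=> z zcl /=; apply/ler_addgt0Pr => e e0.
(* Adding 1 keeps the radius below positive even when [y] is zero. *)
have y1 : 0 < rnorm y + 1 by rewrite ltr_wpDl ?rnorm_ge0.
have d0 : 0 < e / (rnorm y + 1) by rewrite divr_gt0.
have d0' : (0 : R[i]) < (e / (rnorm y + 1))%:C%C by rewrite ltcR.
have [z' [/= z'c]] := zcl _ (nbhsx_ballx z _ d0').
rewrite -ball_normE /ball_ /= normE ltcR => zz'.
have -> : redot z y = redot (z - z') y + redot z' y by rewrite redotBl subrK.
rewrite addrC lerD//; apply: le_trans (redot_le norm_dot _ _) _.
apply: le_trans (_ : e / (rnorm y + 1) * (rnorm y + 1) <= _).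
  by rewrite ler_pM ?rnorm_ge0 ?(ltW zz')// lerDl.
by rewrite divfK// gt_eqF.
Qed.

Lemma halfspace_convex y c : @convex_set R[i] H [set z | redot z y <= c].
Proof.
move=> a b l; rewrite !inE /= => ac bc.
have l0 : (0 : R[i]) <= l%:num by [].
have l1 : l%:num <= 1 :> R[i] by [].
rewrite [X in redot X _](_ : _ = l%:num *: a + (1 - l%:num) *: b)//.
(* A complex scalar that is at least 0 is real, so the weight is a real [t] in [0, 1]. *)
have lE : l%:num = (complex.Re l%:num)%:C%C by rewrite RRe_real// ger0_real.
rewrite lE in l0 l1 *; set t := complex.Re _ in l0 l1 *.
move: l0 l1; rewrite ler0c -[1]/(1%:C%C) lecR => t0 t1.
rewrite redotDl -rmorphB !redotZl; nra.
Qed.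

Lemma hull_redot_le z y : closed_convex_hull V z -> redot z y <= normV y.
Proof.
move=> /(_ [set z | redot z y <= normV y]); apply; split.
  by split; [exact: halfspace_convex|exact: halfspace_closed].
by move=> w Vw /=; rewrite redotC redot_le_normV.
Qed.

Lemma ball_sub_hull_le s y : 0 <= s ->
  [set x | rnorm x <= s] `<=` closed_convex_hull V -> s * rnorm y <= normV y.
Proof.
move=> s0 sV; have [->|y0] := eqVneq y 0.
  by rewrite /rnorm normr0 mulr0 normV_ge0.
have ny0 : rnorm y != 0 by rewrite rnorm_eq0.
(* The point of the ball furthest in the direction of [y]: its real inner product with [y] is s
   ‖y‖. *)
have : rnorm ((s / rnorm y)%:C%C *: y) <= s.
  by rewrite rnormZ rmodR ger0_norm ?divr_ge0 ?rnorm_ge0// divfK.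
move=> /sV /hull_redot_le -/(_ y).
by rewrite redotZl -(rnorm_sqr norm_dot) expr2 mulrA divfK.
Qed.


(* A convex set [A] that avoids a ball around [x] is separated from [x] by
   [x - p] for a point [p] of [A] nearly closest to [x]; comparing [p] with
   [p + t (z - p)] for small [t] replaces the exact projection. *)
Lemma hull_of_normV_ge s x : (forall y, s * rnorm y <= normV y) ->
  rnorm x <= s -> closed_convex_hull V x.
Proof.
move=> sV xs A [[Acvx Acl] VA]; apply: contrapT => nAx.
(* As [A] is closed, [x] lies at positive distance from it. *)
have [d d0 Ad] : exists2 d : R, 0 < d & forall p, A p -> d <= rnorm (x - p).
  have [B /nbhs_ballP[e /= e0 eB] AB] :
      exists2 B : set H, nbhs x B & ~ (A `&` B !=set0).
    apply: contrapT => h; apply: nAx; apply: Acl => B Bx.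
    by apply: contrapT => AB; apply: h; exists B.
  have eE : e = (complex.Re e)%:C%C by rewrite RRe_real// gtr0_real.
  exists (complex.Re e); first by rewrite -ltcR -eE.
  move=> p Ap; rewrite leNgt; apply/negP => xp; apply: AB; exists p.
  split=> //; apply: eB; rewrite -ball_normE /ball_ /= normE eE ltcR//.
pose E := [set rnorm (x - p) ^+ 2 | p in A].
have [v Vv] := V_neq0.
have ED p : A p -> inf E <= rnorm (x - p) ^+ 2.
  move=> Ap; apply: ge_inf; last by exists p.
  by exists 0 => _ [q _ <-]; exact: sqr_ge0.
have D0 : 0 < inf E.
  apply: lt_le_trans (_ : d ^+ 2 <= _); first by rewrite exprn_gt0.
  apply: lb_le_inf; first by exists (rnorm (x - v) ^+ 2), v => //; exact: VA.
  by move=> _ [p Ap <-]; rewrite ler_pXn2r ?nnegrE ?rnorm_ge0 ?(ltW d0)// Ad.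
(* [M - 1] bounds ‖z - p‖² for unit [z], through ‖z - x‖² <= 2 (1 + ‖x‖²) and ‖x - p‖² <=
   [inf E + 1]. The step [t] is small enough that [t * M < inf E]. *)
pose M := 4 * (1 + rnorm x ^+ 2) + 2 * (inf E + 1) + 1.
have M0 : 0 < M by rewrite /M; have := sqr_ge0 (rnorm x); lra.
pose t := inf E / (inf E + M).
have DM : 0 < inf E + M by rewrite addr_gt0.
have t0 : 0 < t by rewrite divr_gt0.
have t1 : t <= 1 by rewrite ler_pdivrMr// mul1r lerDl ltW.
have tM : t * M < inf E.
  by rewrite /t mulrAC ltr_pdivrMr// ltr_pM2l// ltrDr.
have [_ [p Ap <-] pD] : exists2 q, E q & q < inf E + t ^+ 2.
  apply: inf_adherent; first by rewrite exprn_gt0.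
  split; first by exists (rnorm (x - v) ^+ 2), v => //; exact: VA.
  by exists 0 => _ [q _ <-]; exact: sqr_ge0.
set y := x - p in pD.
have t0' : (0 : R[i]) <= t%:C%C by rewrite lecR ltW.
have t1' : t%:C%C <= 1 :> R[i] by rewrite -[1]/(1%:C%C) lecR.
(* The point p + t (z - p) stays in [A], so its squared distance to [x] is at least [inf E].
   Expanding it and using ‖y‖² < [inf E + t ^+ 2] leaves 2t [redot y (z - p)] <= t² M. *)
have Vy z : V z -> redot y z <= redot y p + t * M / 2.
  move=> Vz.
  have Aw : A (t%:C%C *: z + (1 - t%:C%C) *: p).
    have := Acvx z p (Itv01 t0' t1'); rewrite !inE; apply=> //; exact: VA.
  have /ED := Aw.
  have -> : x - (t%:C%C *: z + (1 - t%:C%C) *: p) = y - t%:C%C *: (z - p).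
    rewrite /y scalerBl scale1r scalerBr !opprD !opprK !addrA.
    by rewrite (addrAC x).
  rewrite (rnormB_sqr norm_dot) rnormZ rmodR (ger0_norm (ltW t0)) exprMn.
  rewrite redotZr redotBr.
  have zp : rnorm (z - p) ^+ 2 <= M - 1.
    have := rnormB_sqr_le norm_dot (z - x) (p - x).
    have := rnormB_sqr_le norm_dot z x.
    rewrite (rnorm_V Vz) opprB addrA subrK -(opprB x p) -/y.
    have : rnorm (- y) = rnorm y by rewrite /rnorm normrN.
    have : t ^+ 2 <= 1 by rewrite expr_le1// ltW.
    by move=> ? ->; rewrite /M; lra.
  move=> h.
  have : 2 * t * (redot y z - redot y p) <= t ^+ 2 * M by nra.
  rewrite -mulrA expr2 -mulrA mulrCA ler_pM2l//; lra.
(* Contradiction: s ‖y‖ <= [redot y x] - ‖y‖² + tM/2 <= s ‖y‖ - [inf E] + tM/2 < s ‖y‖. *)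
have := sV y.
have : normV y <= redot y p + t * M / 2 by apply: normV_le.
have : redot y p = redot y x - rnorm y ^+ 2.
  by rewrite (rnorm_sqr norm_dot) -redotBr /y subKr.
have := redot_le norm_dot y x.
have := ED p Ap; rewrite -/y.
have := rnorm_ge0 y.
nra.
Qed.

(** * The inner radius as a lower bound, and the dual norm *)

Hypothesis r_gt0 : 0 < r.

(** [sup] defaults to 0 on a set without a supremum, so a positive value shows that the supremum
    exists. *)
Lemma inner_radius_has_sup :
  has_sup [set s : R | 0 <= s /\ [set x | rnorm x <= s] `<=` closed_convex_hull V].
Proof. by apply: contrapT => /sup_out r0; move: r_gt0; rewrite /r r0 ltxx. Qed.

Lemma inner_radius_le_normV y : r * rnorm y <= normV y.
Proof.
have [->|y0] := eqVneq (rnorm y) 0; first by rewrite mulr0 normV_ge0.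
have y_gt0 : 0 < rnorm y by rewrite lt_def y0 rnorm_ge0.
rewrite -ler_pdivlMr//; apply: ge_sup; first by case: inner_radius_has_sup.
by move=> s [s0 sV]; rewrite ler_pdivlMr// ball_sub_hull_le.
Qed.

(** By homogeneity the bound extends to all vectors; separation then makes [s] an admissible
    radius. *)
Lemma le_inner_radius s : 0 <= s ->
  (forall y, rnorm y = 1 -> s <= normV y) -> s <= r.
Proof.
move=> s0 sV; apply: sup_upper_bound inner_radius_has_sup _ _; split=> // x.
apply: hull_of_normV_ge => y.
have [->|y0] := eqVneq (rnorm y) 0; first by rewrite mulr0 normV_ge0.
have y_gt0 : 0 < rnorm y by rewrite lt_def y0 rnorm_ge0.
rewrite -ler_pdivlMr// mulrC.
have yE : rmod (rnorm y)^-1%:C%C = (rnorm y)^-1.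
  by rewrite rmodR ger0_norm// invr_ge0 rnorm_ge0.
rewrite -yE; apply: le_trans (normVZ_le _ _).
by apply: sV; rewrite rnormZ yE mulVf.
Qed.

(** A competitor [y] satisfies r ‖y‖ <= [normV y] <= 1, and Cauchy-Schwarz concludes. *)
Lemma dual_normV_le x : rnorm x = 1 -> (dual_normV dot V x <= r^-1%:E)%E.
Proof.
move=> x1; apply: ge_ereal_sup => _ [y /= y1 <-]; rewrite lee_fin.
apply: le_trans (rmod_dot_le norm_dot _ _) _; rewrite x1 mul1r.
rewrite -[r^-1]mul1r ler_pdivlMr// mulrC.
exact: le_trans (inner_radius_le_normV y) y1.
Qed.

Lemma le_dual_normV x : rnorm x = 1 -> normV x <= r ->
  (r^-1%:E <= dual_normV dot V x)%E.
Proof.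
move=> x1 xr; have ri : 0 <= r^-1 by rewrite invr_ge0 ltW.
apply: le_trans (_ : (rmod (dot x (r^-1%:C%C *: x)))%:E <= _)%E.
  rewrite lee_fin; apply: le_trans (Re_le_rmod _).
  by rewrite -/(redot _ _) redotZr -(rnorm_sqr norm_dot) x1 expr1n mulr1.
apply: ereal_sup_ubound; exists (r^-1%:C%C *: x) => //=.
apply: le_trans (normVZ_le _ _) _.
by rewrite rmodR ger0_norm// mulrC ler_pdivrMr// mul1r.
Qed.

(* A near-maximiser [y] of [dual_normV x] has norm at most [r^-1], so
   after a rotation it is close to [r^-1 x], whose [normV] is then nearly
   at most one. *)
Lemma dual_normV_eq x : rnorm x = 1 -> dual_normV dot V x = r^-1%:E ->
  normV x <= r.
Proof.
move=> x1 dx; apply/ler_addgt0Pr => e e0.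
have ri : 0 < r^-1 by rewrite invr_gt0.
pose e' := e / r.
have e'0 : 0 < e' by rewrite divr_gt0.
(* Chosen so that ‖x / r - y‖² <= 2u / r = e'²; the final bound is then r (1 + e') = r + e. *)
pose u := e' ^+ 2 * r / 2.
have u0 : 0 < u by rewrite !(mulr_gt0, exprn_gt0, invr_gt0).
have [_ [y0 /= y01 <-]] : exists2 z, [set (rmod (dot x y))%:E | y in
    [set y | normV y <= 1]] z & ((r^-1 - u)%:E < z)%E.
  by apply: ereal_sup_gt; rewrite -/(dual_normV dot V x) dx lte_fin ltrBlDr ltrDl.
rewrite lte_fin; have [l l1 <-] := dot_rotation dot x y0.
set y := l *: y0 => xy.
have y1 : normV y <= 1.
  by apply: le_trans (normVZ_le _ _) _; rewrite /rmod l1 mul1r.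
have yr : rnorm y <= r^-1.
  rewrite -[r^-1]mul1r ler_pdivlMr// mulrC.
  exact: le_trans (inner_radius_le_normV y) y1.
pose w := r^-1%:C%C *: x - y.
have we : rnorm w <= e'.
  rewrite -(@ler_pXn2r _ 2) ?nnegrE ?rnorm_ge0 ?(ltW e'0)// (rnormB_sqr norm_dot).
  rewrite rnormZ rmodR (ger0_norm (ltW ri)) x1 mulr1 redotZl.
  have : rnorm y ^+ 2 <= r^-1 ^+ 2 by rewrite ler_pXn2r ?nnegrE ?rnorm_ge0 ?(ltW ri).
  have : r^-1 * (r^-1 - u) <= r^-1 * redot x y by rewrite ler_pM2l// ltW.
  have : r^-1 * u = e' ^+ 2 / 2 by rewrite /u; field; rewrite gt_eqF.
  lra.
have xE : x = r%:C%C *: (y + w).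
  by rewrite /w addrC subrK scalerA -rmorphM divff ?scale1r ?gt_eqF.
rewrite xE; apply: le_trans (normVZ_le _ _) _.
rewrite rmodR (ger0_norm (ltW r_gt0)).
apply: le_trans (_ : r * (1 + e') <= _).
  rewrite ler_pM2l//; apply: le_trans (normVD_le _ _) _.
  by rewrite lerD// (le_trans (normV_le_rnorm _)).
by rewrite /e' mulrDr mulr1 mulrC divfK ?gt_eqF.
Qed.

End circled_set.

(** * A cycle of implications between the extremal properties *)

Theorem theorem4p2 (R : realType) (H : completeNormedModType R[i])
    (dot : {dot H for Num.Def.conjC}) (norm_dot : norm_from_dot dot)
    (H_neq0 : exists x : H, x != 0)
    (V : set H) (V_sphere : V `<=` @usphere R H) (V_closed : closed V)
    (V1 : forall (l : R[i]) (x : H), `|l| = 1 -> V x -> V (l *: x))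
    (V2 : forall x : H, (forall y : H, V y -> dot x y = 0) -> x = 0)
    (r_gt0 : 0 < inner_radius V) (x : H) (x_unit : usphere x) :
  [<-> (normV dot V x = inner_radius V /\
          forall y : H, usphere y -> normV dot V x <= normV dot V y);
       (dual_normV dot V x = ((inner_radius V)^-1)%:E /\
          forall y : H, usphere y ->
            (dual_normV dot V y <= dual_normV dot V x)%E);
       (distV V x = Num.sqrt (2 * (1 - inner_radius V)) /\
          forall y : H, usphere y -> distV V y <= distV V x);
       maximal_vector V x].
Proof.
(* Were [V] empty, every vector would be orthogonal to it, so [V2] would make [H] zero. *)
have V_neq0 : V !=set0.
  case: H_neq0 => z z0; apply: contrapT => nV; move/eqP: z0; apply.
  by apply: V2 => y Vy; case: nV; exists y.
have x1 : rnorm x = 1 by apply/usphereE.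
have rV y : usphere y -> inner_radius V <= normV dot V y.
  move=> /usphereE y1; rewrite -[leLHS]mulr1 -y1.
  exact: inner_radius_le_normV.
have V_le1 y : usphere y -> normV dot V y <= 1.
  move=> /usphereE <-; exact: normV_le_rnorm.
have distE y : usphere y -> distV V y = Num.sqrt (2 * (1 - normV dot V y)).
  by move=> /usphereE; exact: distVE.
(* Comparing square roots reflects the order because [normV] is at most 1 on the sphere, so the
   radicand is nonnegative. *)
have dist_le y z : usphere y -> usphere z ->
    (distV V y <= distV V z) = (normV dot V z <= normV dot V y).
  move=> yS zS; rewrite !distE// ler_sqrt; last first.
    by have := V_le1 _ zS; lra.
  by apply/idP/idP; lra.
have dist_ub : has_ubound [set distV V y | y in @usphere R H].
  exists (Num.sqrt 2) => _ [y yS <-]; rewrite distE// ler_wsqrtr//.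
  have := rV y yS; lra.
have distS : [set distV V y | y in @usphere R H] (distV V x) by exists x.
tfae.
- move=> [xr _]; have xr' : normV dot V x <= inner_radius V by rewrite xr.
  have dx : dual_normV dot V x = ((inner_radius V)^-1)%:E.
    by apply/eqP; rewrite eq_le dual_normV_le//= le_dual_normV.
  by split=> // y /usphereE y1; rewrite dx dual_normV_le.
- move=> [dx _].
  have xr : normV dot V x = inner_radius V.
    apply/eqP; rewrite eq_le rV// andbT.
    exact: dual_normV_eq dx.
  split; first by rewrite distE// xr.
  by move=> y yS; rewrite dist_le// xr rV.
- move=> [_ xmax]; split=> //; apply/eqP; rewrite eq_le ub_le_sup//=.
  by apply: ge_sup => [|_ [y yS <-]]; [exists (distV V x)|exact: xmax].
(* Maximal distance means minimal [normV]; this minimum is a lower bound over unit vectors, hence an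
   admissible radius, hence at most the inner radius. *)
- move=> [_ dx].
  have xmin y : usphere y -> normV dot V x <= normV dot V y.
    by move=> yS; rewrite -dist_le// dx ub_le_sup//; exists y.
  split=> //; apply/eqP; rewrite eq_le rV// andbT.
  apply: (le_inner_radius norm_dot) => //; first exact: normV_ge0.
  by move=> y /usphereE; exact: xmin.
Qed.
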